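(* Let $p\ge3$ be a prime, and let $C>0$, $0<\gamma<1$, $c_{nsp}>0$ be constants and $\kappa>0$. Let $\mathbf{w}=(w_1,\dots,w_n)$ be a non-zero vector in $\mathbb{Z}^n$ with $|w_i|\le p/2$, and let $\mathbf{w}'=\frac1p\mathbf{w}=(\frac{w_1}{p},\dots,\frac{w_n}{p})$. Let $$\rho(\mathbf{w})=\sup_{r\in\mathbb{F}_p}\Big|\mathbf{P}(x_1w_1+\dots+x_nw_n\equiv r \ (\mathrm{mod}\ p))-\frac1p\Big|,$$ where $x_1,\dots,x_n$ are iid taking values $\pm1$ with probability $1/2$ each. (1) If there is no non-zero $t\in\mathbb{F}_p$ such that $\|(t\mathbf{w})'\|_2<\kappa$, then $\rho(\mathbf{w})\le\exp(-\kappa^2/2)$. (2) Otherwise, assume that $1\le\|\mathbf{w}'\|_2\le\kappa$, that $|\operatorname{supp}(\mathbf{w})|\ge c_{nsp}n$, that $\kappa\le C\sqrt n$, and that $\mathbf{ULCD}_{\gamma,\kappa}(\mathbf{w}')\ge L$. Then $$\rho(\mathbf{w})\le O\Big(\frac{1}{L\|\mathbf{w}'\|_2}+\exp(-\Theta(\kappa^2))\Big),$$ where the implied constants depend on $C,\gamma,c_{nsp}$.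
   Context: Elements of $\mathbb{F}_p$ are identified with the integers in $[-(p-1)/2,(p-1)/2]$. For $t\in\mathbb{F}_p$, $t\mathbf{w}$ is the vector in $\mathbb{F}_p^n$ obtained by multiplication modulo $p$, viewed as an integer vector with entries in $[-(p-1)/2,(p-1)/2]$, and $(t\mathbf{w})'=\frac1p(t\mathbf{w})\in\mathbb{R}^n$. $\operatorname{supp}(\mathbf{w})=\{i:w_i\ne0\}$. For a non-zero vector $\mathbf{w}'\in\frac1p\mathbb{Z}^n$ with $\|\mathbf{w}'\|_\infty\le1/2$, $\mathbf{ULCD}_{\gamma,\kappa}(\mathbf{w}')$ is the smallest positive integer $L$ such that $\operatorname{dist}(L\mathbf{w}',\mathbb{Z}^n)\le\min\{\gamma\|L\mathbf{w}'\|_2,\kappa\}$, where $\operatorname{dist}$ is Euclidean distance. *)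

(* Defs.v *)
From HB Require Import structures.
From mathcomp Require Import all_boot all_order all_algebra.
From mathcomp Require Import all_classical all_reals all_analysis.

Set Implicit Arguments.
Unset Strict Implicit.
Unset Printing Implicit Defensive.

Import Order.TTheory GRing.Theory Num.Theory.
Import numFieldNormedType.Exports.

Local Open Scope classical_set_scope.
Local Open Scope ring_scope.

(* The discrete sigma-algebra on [int], as the library does for [nat], so that
   [{RV P >-> int}] makes sense. *)
HB.instance Definition _ := isPointed.Build int 0.
HB.instance Definition _ := @isMeasurable.Build default_measure_display
  int discrete_measurable discrete_measurable0
  discrete_measurableC discrete_measurableU.

Section EuclideanGeometry.
Context {R : realType} {n : nat}.
Implicit Types (v : 'rV[R]_n) (w : 'rV[int]_n).

(* The norm which the library puts on ['rV[R]_n] is the sup norm. *)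
Definition norm2 v : R := Num.sqrt (\sum_(i < n) v 0 i ^+ 2).

Definition int_row w : 'rV[R]_n := map_mx intr w.

Definition dist_int v : R :=
  inf [set norm2 (v - int_row z) | z in [set: 'rV[int]_n]].

Definition ulcd_pred (gamma kappa : R) v (L : nat) : bool :=
  (0 < L)%N &&
  (dist_int (L%:R *: v) <= Num.min (gamma * norm2 (L%:R *: v)) kappa).

(* The default value 0 is never reached on vectors of [p^-1 * Z^n] with
   [0 < p], see [ulcdP]. *)
Definition ulcd (gamma kappa : R) v : nat :=
  if pselect (exists L, ulcd_pred gamma kappa v L) is left exL
  then ex_minn exL else 0%N.

Definition scale_inv (p : nat) w : 'rV[R]_n := p%:R^-1 *: int_row w.

End EuclideanGeometry.

Lemma ulcdP (R : realType) (n p : nat) (gamma kappa : R) (w : 'rV[int]_n) :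
  (0 < p)%N -> 0 <= gamma -> 0 <= kappa ->
  let L := ulcd gamma kappa (scale_inv p w) in
  ulcd_pred gamma kappa (scale_inv p w) L /\
  forall m, ulcd_pred gamma kappa (scale_inv p w) m -> (L <= m)%N.
Proof.
move=> p0 g0 k0; rewrite /ulcd /=.
case: pselect => [exL|[]]; first by case: ex_minnP.
exists p; rewrite /ulcd_pred p0 /=.
have d0 : dist_int (p%:R *: scale_inv p w : 'rV[R]_n) <= 0.
  have -> : 0 = norm2 (p%:R *: scale_inv p w - int_row w : 'rV[R]_n).
    rewrite /scale_inv scalerA divff ?pnatr_eq0 -?lt0n// scale1r subrr /norm2.
    by rewrite big1 ?sqrtr0// => i _; rewrite mxE expr0n.
  apply: ge_inf; last by exists w.
  by exists 0 => _ [z _ <-]; exact: sqrtr_ge0.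
by rewrite (le_trans d0)// le_min k0 andbT mulr_ge0// sqrtr_ge0.
Qed.

(* The representative of [a] in [-(p-1)/2, (p-1)/2], for an odd prime [p]. *)
Definition crep (p : nat) (a : 'F_p) : int :=
  if (a <= p.-1./2)%N then (a : nat)%:Z else (a : nat)%:Z - p%:Z.

Definition modp_scale (p n : nat) (t : 'F_p) (w : 'rV[int]_n) : 'rV[int]_n :=
  \row_(i < n) crep (t * (w 0 i)%:~R).

Definition supp (n : nat) (w : 'rV[int]_n) : {set 'I_n} :=
  [set i | w 0 i != 0]%SET.

Section RandomSigns.
Context {d : measure_display} {T : measurableType d} {R : realType}.
Variable P : probability T R.

Definition mutually_independent (d' : measure_display)
    (T' : measurableType d') (I : finType) (X : I -> {RV P >-> T'}) : Prop :=
  forall (J : {set I}) (B : I -> set T'), (forall i, measurable (B i)) ->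
    P (\bigcap_(i in [set` J]) (X i @^-1` B i)) =
    (\prod_(i in J) P (X i @^-1` B i))%E.

Definition uniform_sign (X : {RV P >-> int}) : Prop :=
  P (X @^-1` [set 1]) = (2^-1)%:E /\ P (X @^-1` [set - 1]) = (2^-1)%:E.

Definition iid_signs (n : nat) (x : 'I_n -> {RV P >-> int}) : Prop :=
  mutually_independent x /\ forall i, uniform_sign (x i).

Definition rho (p n : nat) (x : 'I_n -> {RV P >-> int}) (w : 'rV[int]_n) : R :=
  sup [set `| fine (P [set s | (\sum_(i < n) x i s * w 0 i)%:~R = r]) - p%:R^-1 |
      | r in [set: 'F_p]].

End RandomSigns.

(* Main.v *)
Require Import Defs.
From mathcomp Require Import all_boot all_order all_algebra.
From mathcomp Require Import all_classical all_reals all_analysis.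
From mathcomp Require Import ring lra zify.

Set Implicit Arguments.
Unset Strict Implicit.
Unset Printing Implicit Defensive.

Import Order.TTheory GRing.Theory Num.Theory.
Import numFieldNormedType.Exports.

Local Open Scope classical_set_scope.
Local Open Scope ring_scope.

(** Write [N u] for the norm of the representative of [u * w / p].  Fourier
    inversion on [F_p] and the bound [cos^2 (pi x) <= exp (- x^2)] give
    [rho w <= p^-1 * \sum_(u != 0) exp (- N u ^ 2 / 2)], which settles the first
    part.  For the second part put [k := c1 * kappa] with [c1] small.  The average
    of [N ^ 2] is at least [#|supp w| / 36 > k ^ 2], so the ball of radius [k] is
    not everything; as [N] is subadditive, walking along the multiples of a
    non-zero point of the ball of radius [s] produces about [k / s] disjoint
    translates of that ball inside the ball of radius [k], so its size is at most
    [6 s / k] times that of the latter.  By definition of ULCD, two points of the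
    ball of radius [k] at distance less than ULCD are at distance at most
    [2 k / (gamma ||w'||)], which bounds its size, and summing the Gaussian
    weights over shells gives the result. *)

(** * Symmetric residues modulo [p] *)

Section SymmetricResidue.
Variable p : nat.
Hypotheses (p_pr : prime p) (p_ge3 : (3 <= p)%N).

Lemma prime_ge3_odd : odd p.
Proof. by case: (even_prime p_pr) => // p2; move: p_ge3; rewrite p2. Qed.

Lemma intr_Fp_eq0 (z : int) : (z%:~R == 0 :> 'F_p) = (p%:Z %| z)%Z.
Proof. by rewrite -(dvdz_pcharf (pchar_Fp p_pr)). Qed.

Lemma Fp2_neq0 : (2 : 'F_p) != 0.
Proof.
have := intr_Fp_eq0 2; rewrite -pmulrn => ->.
by rewrite dvdzE; apply/negP => /dvdn_leq => /(_ isT); rewrite leqNgt p_ge3.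
Qed.

Lemma intr_Fp_natr (a : 'F_p) : ((a : nat)%:Z)%:~R = a.
Proof. by rewrite -pmulrn natr_Zp. Qed.

Lemma ltn_Fp (a : 'F_p) : (a < p)%N.
Proof. by rewrite -[ltnRHS](Fp_cast p_pr) ltn_ord. Qed.

Lemma crepK (a : 'F_p) : (crep a)%:~R = a.
Proof.
rewrite /crep; case: ifP => _; first exact: intr_Fp_natr.
by rewrite rmorphB /= intr_Fp_natr -pmulrn pchar_Fp_0// subr0.
Qed.

Lemma crep_lt (a : 'F_p) : (2 * `|crep a| < p%:Z).
Proof.
have := ltn_Fp a; have := prime_ge3_odd; rewrite /crep; case: ifP => + /=; lia.
Qed.

(** [z] and [crep a] differ by a multiple of [p], and [crep a] is shorter than [p / 2], so adding a
    non-zero multiple can only lengthen it. Parity and subadditivity of the residue both follow from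
    this minimality. *)
Lemma crep_min (z : int) (a : 'F_p) : z%:~R = a -> `|crep a| <= `|z|.
Proof.
move=> za; have := crep_lt a.
have : (p%:Z %| z - crep a)%Z by rewrite -intr_Fp_eq0 rmorphB /= crepK za subrr.
case/dvdzP => k zk; have {zk} -> : z = crep a + k * p%:Z by lia.
have [->|k0] := eqVneq k 0; first by rewrite mul0r addr0.
nia.
Qed.

Lemma crep0 : crep (0 : 'F_p) = 0.
Proof. by apply/eqP; rewrite -normr_le0 -(@normr0 _ int); exact: crep_min. Qed.

Lemma crepN (a : 'F_p) : `|crep (- a)| = `|crep a|.
Proof.
have H (b : 'F_p) : `|crep (- b)| <= `|crep b|.
  by rewrite -(normrN (crep b)); apply: crep_min; rewrite rmorphN /= crepK.
by apply/eqP; rewrite eq_le H/= -{1}[a]opprK H.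
Qed.

Lemma crepD (a b : 'F_p) : `|crep (a + b)| <= `|crep a| + `|crep b|.
Proof.
apply: le_trans (ler_normD _ _); apply: crep_min.
by rewrite rmorphD /= !crepK.
Qed.

End SymmetricResidue.

(** * Monotonicity, homogeneity and the triangle inequality for [norm2] *)

Section EuclideanNorm.
Context {R : realType} {n : nat}.
Implicit Types v u z : 'rV[R]_n.

Lemma norm2_ge0 v : 0 <= norm2 v.
Proof. exact: sqrtr_ge0. Qed.

Lemma norm2_sqr v : norm2 v ^+ 2 = \sum_(i < n) v 0 i ^+ 2.
Proof. by rewrite sqr_sqrtr// sumr_ge0// => i _; exact: sqr_ge0. Qed.

Lemma norm2_eq0 v : norm2 v = 0 -> forall i, v 0 i = 0.
Proof.
move=> v0 i; have := norm2_sqr v; rewrite v0 expr0n /= => /esym/eqP.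
rewrite psumr_eq0; last by move=> j _; exact: sqr_ge0.
by move=> /allP/(_ i); rewrite mem_index_enum sqrf_eq0 => /(_ isT)/eqP.
Qed.

Lemma ler_norm2 v u : (forall i, `|v 0 i| <= `|u 0 i|) -> norm2 v <= norm2 u.
Proof.
move=> vu; rewrite ler_sqrt; last by rewrite sumr_ge0// => i _; exact: sqr_ge0.
apply: ler_sum => i _; rewrite -[leLHS]real_normK ?num_real//.
by rewrite -[leRHS]real_normK ?num_real// lerXn2r ?nnegrE.
Qed.

Lemma norm2Z (a : R) v : 0 <= a -> norm2 (a *: v) = a * norm2 v.
Proof.
move=> a0; apply/eqP.
rewrite -(@eqrXn2 _ 2) ?norm2_ge0 ?mulr_ge0 ?norm2_ge0//.
rewrite exprMn !norm2_sqr mulr_sumr; apply/eqP/eq_bigr => i _.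
by rewrite mxE exprMn.
Qed.

(* For [x, y > 0] one has [(a + b)^2 <= (1 + y/x) a^2 + (1 + x/y) b^2]; with
   [x, y] the two norms, summing over the coordinates gives [(x + y)^2]. *)
Lemma ler_norm2D v u z : (forall i, `|z 0 i| <= `|v 0 i| + `|u 0 i|) ->
  norm2 z <= norm2 v + norm2 u.
Proof.
move=> zvu.
have [v0|v0] := eqVneq (norm2 v) 0.
  rewrite v0 add0r; apply: ler_norm2 => i.
  by have := zvu i; rewrite (norm2_eq0 v0) normr0 add0r.
have [u0|u0] := eqVneq (norm2 u) 0.
  rewrite u0 addr0; apply: ler_norm2 => i.
  by have := zvu i; rewrite (norm2_eq0 u0) normr0 addr0.
set x := norm2 v; set y := norm2 u.
have x0 : 0 < x by rewrite lt_neqAle eq_sym v0 norm2_ge0.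
have y0 : 0 < y by rewrite lt_neqAle eq_sym u0 norm2_ge0.
rewrite -(@ler_pXn2r _ 2) ?nnegrE ?addr_ge0 ?norm2_ge0// -/x -/y.
have -> : (x + y) ^+ 2 = (1 + y / x) * x ^+ 2 + (1 + x / y) * y ^+ 2.
  by field; rewrite !gt_eqF.
rewrite norm2_sqr (norm2_sqr v : x ^+ 2 = _) (norm2_sqr u : y ^+ 2 = _).
rewrite !mulr_sumr -big_split /=; apply: ler_sum => i _.
rewrite -[leLHS]real_normK ?num_real//.
rewrite -[v 0 i ^+ 2]real_normK ?num_real// -[u 0 i ^+ 2]real_normK ?num_real//.
apply: (@le_trans _ _ ((`|v 0 i| + `|u 0 i|) ^+ 2)).
  by rewrite lerXn2r ?nnegrE// addr_ge0.
rewrite -subr_ge0; set a := `|v 0 i|; set b := `|u 0 i|.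
suff -> : (1 + y / x) * a ^+ 2 + (1 + x / y) * b ^+ 2 - (a + b) ^+ 2
   = (y * a - x * b) ^+ 2 / (x * y).
  by rewrite divr_ge0 ?sqr_ge0// mulr_ge0// ltW.
by field; rewrite !gt_eqF.
Qed.

End EuclideanNorm.

(** * The norm of the multiples of [w] modulo [p], a subadditive even function on ['F_p] *)

Section MultipleNorm.
Context (R : realType) (p n : nat) (w : 'rV[int]_n).
Hypotheses (p_pr : prime p) (p_ge3 : (3 <= p)%N).

Definition mulnorm (u : 'F_p) : R := norm2 (scale_inv p (modp_scale u w)).

Lemma mulnorm_ge0 u : 0 <= mulnorm u.
Proof. exact: norm2_ge0. Qed.

Lemma scale_invE (z : 'rV[int]_n) i :
  (scale_inv p z : 'rV[R]_n) 0 i = (z 0 i)%:~R / p%:R.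
Proof. by rewrite !mxE mulrC. Qed.

Lemma mulnorm_sqr u :
  mulnorm u ^+ 2 = \sum_(i < n) ((crep (u * (w 0 i)%:~R))%:~R / p%:R) ^+ 2.
Proof.
by rewrite norm2_sqr; apply: eq_bigr => i _; rewrite scale_invE mxE.
Qed.

Lemma mulnorm0 : mulnorm 0 = 0.
Proof.
apply/eqP; rewrite -sqrf_eq0 mulnorm_sqr big1// => i _.
by rewrite mul0r expr0n.
Qed.

Lemma mulnormN u : mulnorm (- u) = mulnorm u.
Proof.
have H v : mulnorm (- v) <= mulnorm v.
  apply: ler_norm2 => i; rewrite !scale_invE !mxE mulNr !normrM.
  by rewrite ler_wpM2r// -!intr_norm crepN.
by apply/eqP; rewrite eq_le H -{1}[u]opprK H.
Qed.

Lemma mulnormD u v : mulnorm (u + v) <= mulnorm u + mulnorm v.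
Proof.
apply: ler_norm2D => i; rewrite !scale_invE !mxE !normrM -mulrDl.
by rewrite ler_wpM2r// -!intr_norm -intrD ler_int mulrDl crepD.
Qed.

Lemma mulnormB u v : mulnorm (u - v) <= mulnorm u + mulnorm v.
Proof. by rewrite -[mulnorm v]mulnormN mulnormD. Qed.

End MultipleNorm.

(** * A Gaussian bound on the squared cosine *)

Section CosineBound.
Context {R : realType}.
Implicit Types x t : R.

(* If [sin t < t/pi], the mean value theorem gives [u < t < v] with
   [cos u < 1/pi <= cos v], although [cos] decreases on [[0, pi]]. *)
Lemma sin_ge_div_pi t : 0 <= t <= pi / 2 -> t / pi <= sin t.
Proof.
have pi0 := pi_gt0 R.
case/andP=> t0 tpi; rewrite leNgt; apply/negP => st.
have {}t0 : 0 < t.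
  rewrite lt_neqAle t0 andbT; apply: contraTneq st => <-.
  by rewrite mul0r sin0 ltxx.
have {}tpi : t < pi / 2.
  rewrite lt_neqAle tpi andbT; apply: contraTneq st => ->.
  rewrite sin_pihalf mulrAC divff ?gt_eqF// -leNgt; lra.
have D (a b : R) : a < b -> exists2 c, c \in `]a, b[ & sin b - sin a = cos c * (b - a).
  move=> ab; apply: (MVT ab) => //.
  by apply: continuous_subspaceT => y; exact: continuous_sin.
have [u] := D _ _ t0; rewrite in_itv /= sin0 !subr0 => /andP[u0 ut] su.
have [v] := D _ _ tpi; rewrite in_itv /= sin_pihalf => /andP[tv vpi] sv.
have cuv : cos v < cos u by rewrite ltr_cos ?in_itv /= ?ut; lra.
have cu : cos u < pi^-1 by rewrite -(ltr_pM2r t0) -su mulrC.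
have tp : 0 < pi / 2 - t by lra.
have cv : pi^-1 * (pi / 2 - t) < cos v * (pi / 2 - t).
  have -> : pi^-1 * (pi / 2 - t) = 2^-1 - t / pi.
    by rewrite mulrBr mulrA mulVf ?gt_eqF// mul1r [_ * t]mulrC.
  rewrite -sv; lra.
by move: cv; rewrite ltr_pM2r//; lra.
Qed.

(** With [t = pi * x], [sin_ge_div_pi] gives [sin (pi * x) >= x] for [x >= 0]; hence
    [cos^2 <= 1 - x^2], which is below the exponential. *)
Lemma cos_pi_sqr_le x : `|x| <= 2^-1 -> cos (pi * x) ^+ 2 <= expR (- x ^+ 2).
Proof.
have pi0 := pi_gt0 R.
wlog x0 : x / 0 <= x.
  move=> H; have [x0|/ltW x0] := leP 0 x; first exact: H.
  by rewrite -normrN => /H; rewrite oppr_ge0 mulrN cosN sqrrN; exact.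
rewrite ger0_norm// => x2; apply: le_trans (expR_ge1Dx _).
have -> : cos (pi * x) ^+ 2 = 1 - sin (pi * x) ^+ 2.
  by rewrite -(cos2Dsin2 (pi * x)) addrK.
rewrite lerD2l lerN2 lerXn2r ?nnegrE//.
- by rewrite sin_ge0_pi// mulr_ge0 ?(ltW pi0)//= ler_piMr ?(ltW pi0)//; lra.
- have xpi : 0 <= pi * x <= pi / 2 by rewrite mulr_ge0 ?(ltW pi0)//= ler_pM2l.
  by have := sin_ge_div_pi xpi; rewrite mulrAC divff ?gt_eqF// mul1r.
Qed.

End CosineBound.

(** * Averaging a cosine over all sign patterns *)

Section SignAverage.
Context {R : realType} {I : finType}.
Implicit Types (s : {ffun I -> bool}) (b : I -> R) (c : R).

(** The sum runs over a list while [s] assigns a sign to all of [I]: induction on the list then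
    keeps the set of sign patterns fixed. *)
Definition signed_sum b s (r : seq I) : R := \sum_(i <- r) (-1) ^+ s i * b i.

(** Induction on [r]. Flipping the sign at the head [i] permutes the patterns, so twice the sum
    pairs [cos (y + b i)] with [cos (y - b i)], and each pair equals [2 * cos y * cos (b i)]. *)
Lemma sum_cos_signed_sum b c (r : seq I) : uniq r ->
  \sum_(s : {ffun I -> bool}) cos (c + signed_sum b s r) =
  #|{ffun I -> bool}|%:R * (cos c * \prod_(i <- r) cos (b i)).
Proof.
elim: r => [_|i r IHr] /=.
  under eq_bigr do rewrite /signed_sum big_nil addr0.
  by rewrite sumr_const big_nil mulr1 mulr_natl.
case/andP=> ir /IHr {}IHr.
pose flip s : {ffun I -> bool} := [ffun j => if j == i then ~~ s j else s j].
have flipK : involutive flip.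
  by move=> s; apply/ffunP => j; rewrite !ffunE; case: eqP; rewrite ?negbK.
have flip_r s : signed_sum b (flip s) r = signed_sum b s r.
  apply: eq_big_seq => j jr; rewrite ffunE.
  by case: eqP jr ir => // -> ->.
have two : (2 : R) != 0 by [].
apply: (mulfI two).
set S := \sum_(_ | _) _.
have Sflip : S = \sum_(s : {ffun I -> bool}) cos (c + signed_sum b (flip s) (i :: r)).
  by rewrite /S (reindex_inj (inv_inj flipK)).
have -> : 2 * S = S + S by ring.
rewrite {2}Sflip /S.
rewrite -big_split big_cons /=.
transitivity (\sum_(s : {ffun I -> bool}) cos (c + signed_sum b s r) * (2 * cos (b i))).
  apply: eq_bigr => s _; rewrite /signed_sum !big_cons -!/(signed_sum _ _ _).
  rewrite flip_r ffunE eqxx addrCA [X in _ + cos X]addrCA.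
  by case: (s i); rewrite /= expr1 expr0 mulN1r mul1r !cosD cosN sinN; ring.
by rewrite -mulr_suml IHr; ring.
Qed.

End SignAverage.

(** * Additive characters of ['F_p] through real cosines and sines *)

Section CosineModP.
Context {R : realType} {p : nat}.
Hypotheses (p_pr : prime p) (p_ge3 : (3 <= p)%N).

Let p_gt0 : 0 < p%:R :> R.
Proof. by rewrite ltr0n prime_gt0. Qed.

Let theta : R := pi *+ 2 / p%:R.

Lemma periodic_modp (f : R -> R) (y z : int) : periodic f (pi *+ 2) ->
  y%:~R = z%:~R :> 'F_p -> f (theta * y%:~R) = f (theta * z%:~R).
Proof.
move=> fper yz.
wlog zy : y z yz / z <= y.
  by move=> H; have [/H|/ltW/H] := leP z y; [exact|move=> ->].
have : (p%:Z %| y - z)%Z by rewrite -intr_Fp_eq0// rmorphB /= yz subrr.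
case/dvdzP => k yzk; have p1 := prime_gt0 p_pr.
have k0 : 0 <= k by nia.
have -> : y = z + `|k|%N%:Z * p%:Z by rewrite gez0_abs//; lia.
rewrite intrD intrM -!pmulrn mulrDr.
rewrite [X in _ + X](_ : _ = pi *+ 2 *+ `|k|%N); first exact: periodicn.
by rewrite /theta [_ * p%:R]mulrC mulrA divfK ?gt_eqF// mulr_natr.
Qed.

(** [cosp] and [sinp] are the real and imaginary parts of the character sending [a] to
    [exp (2 i pi a / p)]. *)
Definition cosp (a : 'F_p) : R := cos (theta * (a : nat)%:R).
Definition sinp (a : 'F_p) : R := sin (theta * (a : nat)%:R).

Lemma cosp_intr (z : int) : cosp z%:~R = cos (theta * z%:~R).
Proof.
rewrite /cosp pmulrn; apply: periodic_modp; first exact: cosD2pi.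
by rewrite intr_Fp_natr.
Qed.

Lemma sinp_intr (z : int) : sinp z%:~R = sin (theta * z%:~R).
Proof.
rewrite /sinp pmulrn; apply: periodic_modp; first exact: sinD2pi.
by rewrite intr_Fp_natr.
Qed.

Lemma cospD a b : cosp (a + b) = cosp a * cosp b - sinp a * sinp b.
Proof.
rewrite -(intr_Fp_natr a) -(intr_Fp_natr b) -rmorphD /=.
by rewrite !cosp_intr !sinp_intr intrD mulrDr cosD.
Qed.

Lemma sinpD a b : sinp (a + b) = sinp a * cosp b + cosp a * sinp b.
Proof.
rewrite -(intr_Fp_natr a) -(intr_Fp_natr b) -rmorphD /=.
by rewrite !cosp_intr !sinp_intr intrD mulrDr sinD.
Qed.

(** [a / 2] is the half in ['F_p]. By the double angle formula [cosp (a / 2) ^+ 2] is determined by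
    [cosp a], hence equals [cos (pi * x) ^+ 2] for the symmetric representative [x] of [a / p],
    where [|x| <= 1/2]. *)
Lemma cosp_le_expR a :
  `|cosp (a / 2)| <= expR (- (((crep a)%:~R / p%:R) ^+ 2 / 2)).
Proof.
set x := _ / p%:R.
have two := Fp2_neq0 p_pr p_ge3.
rewrite -(@ler_pXn2r _ 2) ?nnegrE ?expR_ge0// real_normK ?num_real//.
rewrite -expRM_natl mulrN mulrCA divff// mulr1.
have xE : pi * x *+ 2 = theta * (crep a)%:~R.
  by rewrite /theta /x -mulr_natr -[pi *+ 2]mulr_natr; ring.
suff -> : cosp (a / 2) ^+ 2 = cos (pi * x) ^+ 2.
  apply: cos_pi_sqr_le; rewrite normrM normfV (gtr0_norm p_gt0) ler_pdivrMr//.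
  by have := crep_lt p_pr p_ge3 a; rewrite -(ltr_int R) intrM intr_norm -!pmulrn; lra.
have : cosp a = cosp (a / 2) ^+ 2 *+ 2 - 1.
  have -> : cosp a = cosp (a / 2 + a / 2).
    by congr cosp; rewrite -mulrDl -mulr2n -(mulr_natr a 2) mulfK.
  have : cosp (a / 2) ^+ 2 + sinp (a / 2) ^+ 2 = 1 := cos2Dsin2 _.
  by rewrite cospD => <-; ring.
rewrite -{1}[a](crepK p_pr) cosp_intr -xE cos_mulr2n => /addIr.
set y := cos _; set z := cosp _; lra.
Qed.

Lemma sum_cosp (a : 'F_p) :
  \sum_(u : 'F_p) cosp (u * a) = if a == 0 then p%:R else 0.
Proof.
have [->|a0] := eqVneq.
  under eq_bigr do rewrite mulr0 /cosp mulr0 cos0.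
  by rewrite sumr_const card_Fp.
transitivity (\sum_(u : 'F_p) cosp u).
  by rewrite [RHS](reindex_inj (mulIf a0)).
(* Translating the index by 1 shows that [(c, s)] is fixed by the rotation of angle [2 pi / p]; this
   rotation is not the identity, so [c = 0]. *)
set c := \sum_(u : 'F_p) cosp u; pose s := \sum_(u : 'F_p) sinp u.
have c1 : c = c * cosp 1 - s * sinp 1.
  rewrite /c {1}(reindex_inj (addIr 1)) /=.
  under eq_bigr do rewrite cospD.
  by rewrite sumrB -!mulr_suml.
have s1 : s = s * cosp 1 + c * sinp 1.
  rewrite /s {1}(reindex_inj (addIr 1)) /=.
  under eq_bigr do rewrite sinpD.
  by rewrite big_split /= -!mulr_suml.
have cs : cosp 1 ^+ 2 + sinp 1 ^+ 2 = 1 by exact: cos2Dsin2.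
have c1_lt1 : cosp 1 < 1.
  have -> : cosp 1 = cos (pi / p%:R *+ 2).
    by rewrite (cosp_intr 1) mulr1 /theta mulrnAl.
  have : 0 < sin (pi / p%:R : R).
    rewrite sin_gt0_pi// divr_gt0 ?pi_gt0//= ltr_pdivrMr//.
    by rewrite ltr_pMr ?pi_gt0// ltr1n; lia.
  rewrite cos_mulr2n; have := cos2Dsin2 (pi / p%:R : R).
  by move=> cs1 /(exprn_gt0 2); lra.
have : c * (2 * (1 - cosp 1)) = 0.
  (* This is the squared modulus of [1 - exp (2 i pi / p)], the determinant of the linear system
     satisfied by [c] and [s]. *)
  have -> : 2 * (1 - cosp 1) = (1 - cosp 1) ^+ 2 + sinp 1 ^+ 2 by nra.
  have h1 : c * (1 - cosp 1) = - s * sinp 1 by rewrite mulrBr mulr1 {1}c1; ring.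
  have h2 : s * (1 - cosp 1) = c * sinp 1 by rewrite mulrBr mulr1 {1}s1; ring.
  by rewrite mulrDr expr2 mulrA h1 mulrAC mulNr h2; ring.
by move=> /eqP; rewrite mulf_eq0 => /orP[/eqP//|]; rewrite mulf_eq0 ?gt_eqF//; lra.
Qed.

End CosineModP.

(** * Fourier inversion for signed sums modulo [p] *)

Section FourierBound.
Context (R : realType) (p n : nat) (w : 'rV[int]_n).
Hypotheses (p_pr : prime p) (p_ge3 : (3 <= p)%N).

Let p_gt0 : 0 < p%:R :> R.
Proof. by rewrite ltr0n prime_gt0. Qed.

Definition rademacher_sum (s : {ffun 'I_n -> bool}) : int :=
  \sum_(i < n) (-1) ^+ s i * w 0 i.

Lemma sum_cosp_rademacher (u r : 'F_p) :
  \sum_s cosp (u * ((rademacher_sum s)%:~R - r)) =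
  #|{ffun 'I_n -> bool}|%:R *
  (cosp (u * r) * \prod_(i < n) cosp (u * (w 0 i)%:~R)) :> R.
Proof.
pose theta : R := pi *+ 2 / p%:R.
have coE (z : int) : cosp (u * z%:~R) = cos (theta * ((u : nat)%:R * z%:~R)) :> R.
  by rewrite -{1}(intr_Fp_natr u) -intrM cosp_intr// intrM -pmulrn.
rewrite -{2}(intr_Fp_natr r) coE -(cosN (theta * _)).
under [X in _ * (_ * X)]eq_bigr do rewrite coE.
rewrite -sum_cos_signed_sum ?index_enum_uniq//; apply: eq_bigr => s _.
rewrite -{1}(intr_Fp_natr r) -intrB coE; congr cos.
rewrite intrB !mulrBr addrC; congr (_ + _).
rewrite /rademacher_sum /signed_sum raddf_sum !mulr_sumr /=; apply: eq_bigr => i _.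
by rewrite intrM rmorphXn /= rmorphN1; ring.
Qed.

Lemma prod_cosp_le (u : 'F_p) :
  \prod_(i < n) `|cosp (u / 2 * (w 0 i)%:~R)| <=
  expR (- (mulnorm R w u ^+ 2 / 2)).
Proof.
rewrite mulnorm_sqr// mulr_suml -sumrN expR_sum; apply: ler_prod => i _.
by rewrite normr_ge0/= mulrAC; apply: cosp_le_expR.
Qed.

(** Orthogonality ([sum_cosp]) detects the event, and the sign average factors into cosines. The
    frequency 0 contributes exactly [p^-1], which cancels. *)
Lemma rademacher_fourier (r : 'F_p) :
  `|#|[set s | (rademacher_sum s)%:~R == r]%SET|%:R / #|{ffun 'I_n -> bool}|%:R
    - p%:R^-1| <=
  p%:R^-1 * \sum_(u : 'F_p | u != 0) expR (- (mulnorm R w u ^+ 2 / 2)).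
Proof.
set m : R := #|{ffun _}|%:R.
have m0 : m != 0.
  by rewrite pnatr_eq0 -lt0n; apply/card_gt0P; exists [ffun => true].
pose F (u : 'F_p) : R := cosp (u * r) * \prod_(i < n) cosp (u * (w 0 i)%:~R).
have -> : #|[set s | (rademacher_sum s)%:~R == r]%SET|%:R =
    p%:R^-1 * \sum_u (m * F u).
  rewrite -sum1_card natr_sum big_mkcond /=.
  under [in RHS]eq_bigr do rewrite -sum_cosp_rademacher.
  rewrite exchange_big mulr_sumr /=; apply: eq_bigr => s _.
  rewrite sum_cosp// subr_eq0 inE; case: ifP => _; last by rewrite mulr0.
  by rewrite mulVf// gt_eqF.
rewrite -mulr_sumr mulrCA [m * _]mulrC mulfK// (bigD1 0)//= mulrDr.
have -> : F 0 = 1.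
  rewrite /F mul0r big1 ?mulr1; first by rewrite /cosp mulr0 cos0.
  by move=> i _; rewrite mul0r /cosp mulr0 cos0.
rewrite mulr1 addrAC subrr add0r normrM gtr0_norm ?invr_gt0//.
rewrite ler_pM2l ?invr_gt0//; apply: le_trans (ler_norm_sum _ _ _) _.
have two := Fp2_neq0 p_pr p_ge3.
have two' : (2 : 'F_p)^-1 != 0 by rewrite invr_eq0.
(* Replacing [u] by [u / 2] permutes the non-zero frequencies and gives the halved arguments of
   [prod_cosp_le]. *)
rewrite (reindex_inj (mulIf two')) /=.
under eq_bigl do rewrite mulf_eq0 (negPf two') orbF.
apply: ler_sum => u _; apply: le_trans (prod_cosp_le u).
rewrite normrM normr_prod ler_piMl ?cos_max// prodr_ge0// => i _.
Qed.

End FourierBound.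

(** * Joint law of independent uniform signs *)

Section SignDistribution.
Context {d : measure_display} {T : measurableType d} {R : realType}.
Context (P : probability T R) (n : nat) (x : 'I_n -> {RV P >-> int}).
Hypothesis x_signs : iid_signs x.
Implicit Types (s : {ffun 'I_n -> bool}) (F : {set {ffun 'I_n -> bool}}).

Let atom s : set T := \bigcap_(i in [set` [set: 'I_n]%SET]) (x i @^-1` [set (-1) ^+ s i]).

Let measurable_discrete_preimage i (B : set int) : measurable (x i @^-1` B).
Proof. by rewrite -[X in measurable X]setTI; exact: measurable_funPT. Qed.

Let measurable_atom s : measurable (atom s).
Proof.
apply: fin_bigcap_measurable => [|i _]; first exact: finite_finset.
exact: measurable_discrete_preimage.
Qed.

Let probability_atom s : P (atom s) = (#|{ffun 'I_n -> bool}|%:R^-1)%:E.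
Proof.
rewrite x_signs.1//.
rewrite (eq_bigr (fun=> (2^-1)%:E)); last first.
  move=> i _; have [] := x_signs.2 i.
  by case: (s i); rewrite ?expr1 ?expr0.
rewrite prodEFin prodr_const cardsT card_ord card_ffun card_bool card_ord.
by rewrite natrX exprVn.
Qed.

Let trivIset_atom (D : set {ffun 'I_n -> bool}) : trivIset D atom.
Proof.
move=> s t _ _ [y [sy ty]]; apply/ffunP => i.
have := sy i (finset.in_setT i); rewrite /= (ty i (finset.in_setT i)).
by case: (s i); case: (t i).
Qed.

Let probability_atoms F : P (\bigcup_(s in [set` F]) atom s) =
  (#|F|%:R / #|{ffun 'I_n -> bool}|%:R)%:E.
Proof.
rewrite measure_fin_bigcup//.
rewrite (_ : [set` F] = [set` enum F]); last first.
  by apply/seteqP; split=> s /=; rewrite mem_enum.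
rewrite -fsbig_seq ?enum_uniq// big_enum /=.
rewrite (eq_bigr (fun=> (#|{ffun 'I_n -> bool}|%:R^-1)%:E)) => [|s _].
  by rewrite sumEFin sumr_const mulr_natl.
exact: probability_atom.
Qed.

Let measurable_event (A : pred {ffun 'I_n -> int}) :
  measurable [set y | A [ffun i => x i y]].
Proof.
(* The event is split according to the value [z] of the integer vector; there are countably many
   such [z], and those outside [A] contribute the empty set. *)
have -> : [set y | A [ffun i => x i y]] = \bigcup_(z : {ffun 'I_n -> int})
    (if A z then \bigcap_(i in [set: 'I_n]) (x i @^-1` [set z i]) else set0).
  apply/seteqP; split=> [y /= Ay|y [z _]].
    by exists [ffun i => x i y] => //; rewrite Ay => i _ /=; rewrite ffunE.
  case: ifP => // Az zy; rewrite /= (_ : [ffun i => _] = z)//.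
  by apply/ffunP => i; rewrite ffunE; exact: (zy i).
apply: countable_bigcupT_measurable => [|z]; first exact: countableP.
case: ifP => // _; apply: fin_bigcap_measurable => //.
Qed.

(* The atoms of [A] and those of its complement lie in the event and in its
   complement, and their probabilities already add up to 1. *)
Lemma probability_signs (A : pred {ffun 'I_n -> int}) :
  P [set y | A [ffun i => x i y]] =
  (#|[set s : {ffun 'I_n -> bool} | A [ffun i => (-1) ^+ s i]]%SET|%:R
   / #|{ffun 'I_n -> bool}|%:R)%:E.
Proof.
pose good (B : pred {ffun 'I_n -> int}) :=
  [set s : {ffun 'I_n -> bool} | B [ffun i => (-1) ^+ s i]]%SET.
have lower (B : pred {ffun 'I_n -> int}) :
    ((#|good B|%:R / #|{ffun 'I_n -> bool}|%:R)%:E <=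
     P [set y | B [ffun i => x i y]])%E.
  rewrite -probability_atoms; apply: le_measure.
  - rewrite inE; apply: fin_bigcup_measurable => [|s _]; first exact: finite_finset.
    exact: measurable_atom.
  - by rewrite inE; exact: measurable_event.
  move=> y [s /=]; rewrite inE => Bs sy.
  rewrite (_ : [ffun i => x i y] = [ffun i => (-1) ^+ s i])//.
  by apply/ffunP => i; rewrite !ffunE (sy i (finset.in_setT i)).
apply/eqP; rewrite eq_le lower andbT.
have := lower (predC A).
rewrite (_ : [set y | _] = ~` [set y | A [ffun i => x i y]]); last first.
  by apply/seteqP; split => y /negP.
rewrite probability_setC//.
have -> : good (predC A) = (~: good A)%SET by apply/setP => s; rewrite !inE.
rewrite cardsCs finset.setCK.
have m0 : #|{ffun 'I_n -> bool}|%:R != 0 :> R.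
  by rewrite pnatr_eq0 -lt0n; apply/card_gt0P; exists [ffun=> true].
have le : (#|good A| <= #|{ffun 'I_n -> bool}|)%N by exact: max_card.
rewrite natrB// mulrBl divff//.
have /fineK <- := fin_num_measure P _ (measurable_event A).
by rewrite -EFinB !lee_fin lerD2l lerN2.
Qed.

End SignDistribution.

(** * The Fourier bound on [rho] and the case without small multiples *)

Section RhoBound.
Context {d : measure_display} {T : measurableType d} {R : realType}.
Context (P : probability T R) (p n : nat) (x : 'I_n -> {RV P >-> int}).
Context (w : 'rV[int]_n).
Hypotheses (p_pr : prime p) (p_ge3 : (3 <= p)%N) (x_signs : iid_signs x).

Lemma rho_fourier :
  rho p x w <= p%:R^-1 * \sum_(u : 'F_p | u != 0) expR (- (mulnorm R w u ^+ 2 / 2)).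
Proof.
apply: ge_sup; first by eexists; exists 0.
move=> _ [r _ <-].
pose A (z : {ffun 'I_n -> int}) := (\sum_(i < n) z i * w 0 i)%:~R == r.
have -> : [set s | (\sum_(i < n) x i s * w 0 i)%:~R = r] = [set s | A [ffun i => x i s]].
  apply/seteqP; split=> s /=; rewrite /A; under [X in X%:~R == _]eq_bigr do rewrite ffunE.
    by move=> ->.
  by move=> /eqP.
rewrite probability_signs//=.
have -> : [set s : {ffun 'I_n -> bool} | A [ffun i => (-1) ^+ s i]]%SET =
    [set s | (rademacher_sum w s)%:~R == r]%SET.
  by apply/setP => s; rewrite !inE /A /rademacher_sum; under eq_bigr do rewrite ffunE.
exact: rademacher_fourier.
Qed.

Lemma rho_le_expR (kappa : R) : 0 <= kappa ->
  (forall u : 'F_p, u != 0 -> kappa <= mulnorm R w u) ->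
  rho p x w <= expR (- (kappa ^+ 2 / 2)).
Proof.
move=> kappa0 wkappa; apply: le_trans rho_fourier _.
have p0 : 0 < p%:R :> R by rewrite ltr0n prime_gt0.
rewrite mulrC ler_pdivrMr//.
apply: (@le_trans _ _ (\sum_(u : 'F_p) expR (- (kappa ^+ 2 / 2)))).
  rewrite big_mkcond; apply: ler_sum => u _; case: ifP => [u0|_]; last exact: expR_ge0.
  by rewrite ler_expR lerN2 ler_pM2r// lerXn2r ?nnegrE ?mulnorm_ge0 ?wkappa.
by rewrite sumr_const card_Fp// mulr_natr.
Qed.

End RhoBound.

(** * Packing translates of small balls into a larger ball *)

Section Packing.
Context (R : realType) (p n : nat) (w : 'rV[int]_n).
Hypotheses (p_pr : prime p) (p_ge3 : (3 <= p)%N).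

Let N := mulnorm R w : 'F_p -> R.

Definition mulball (s : R) : {set 'F_p} := [set u | mulnorm R w u <= s]%SET.

Lemma mulballS s t : s <= t -> mulball s \subset mulball t.
Proof. by move=> st; apply/fintype.subsetP => u; rewrite !inE => /le_trans; apply. Qed.

(* Walking along the multiples of [u] the norm increases by at most [s] per
   step, so it cannot jump over the interval. *)
Lemma mulnorm_intermediate (u v : 'F_p) (s t : R) : u != 0 -> N u <= s ->
  0 <= t -> t < N v -> exists y, t < N y <= t + s.
Proof.
move=> u0 us t0 tv.
have ex : exists j : nat, t < N (j%:R * u).
  (* As [u] is invertible, [v] itself is a multiple of [u]. The first multiple of norm above [t]
     follows one of norm at most [t]. *)
  by exists (v / u : 'F_p); rewrite natr_Zp divfK.
case: (ex_minnP ex) => -[|j].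
  by rewrite mul0r /N mulnorm0// => /(le_lt_trans t0); rewrite ltxx.
move=> tj jmin; exists (j.+1%:R * u); rewrite tj /=.
rewrite -natr1 mulrDl mul1r; apply: le_trans (mulnormD _ _ _ _ _ _) _ => //.
rewrite lerD// leNgt; apply/negP => /jmin; by rewrite ltnn.
Qed.

(* The translates of the small ball by points of norm in [3is, 3is + s] are
   disjoint. *)
Lemma card_mulball_packing (s k : R) (u v : 'F_p) :
  0 < s -> s <= k -> u != 0 -> N u <= s -> k < N v ->
  #|mulball s|%:R <= 6 * s / k * #|mulball k|%:R :> R.
Proof.
move=> s0 sk u0 us kv.
have k0 : 0 < k by exact: lt_le_trans sk.
(* For [k < 4 s] the factor [6 s / k] exceeds 1 and inclusion suffices. *)
have [k4|k4] := ltP k (4 * s).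
  apply: (@le_trans _ _ (#|mulball k|%:R)).
    by rewrite ler_nat subset_leq_card// mulballS.
  by rewrite ler_peMl// ler_pdivlMr//; lra.
(* The largest [m] with [(3 m + 2) s <= k], so that all translates stay in the ball of radius [k];
   maximality gives [k / s < 3 m + 5 <= 6 (m + 1)]. *)
pose m := Num.truncn ((k / s - 2) / 3).
have ks4 : 4 <= k / s by rewrite ler_pdivlMr.
have := @truncn_itv _ ((k / s - 2) / 3); rewrite -/m.
have -> : 0 <= (k / s - 2) / 3 by apply: divr_ge0 => //; lra.
move=> /(_ isT)/andP[m1 m2].
have m1' : 3 * m%:R * s + 2 * s <= k.
  by move: m1; rewrite -{2}(divfK (lt0r_neq0 s0) k) -mulrDl ler_pM2r//; lra.
have ex (i : 'I_m.+1) : exists y, 3 * i%:R * s < N y <= 3 * i%:R * s + s.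
  apply: (@mulnorm_intermediate u v) => //.
    by rewrite !mulr_ge0// ltW.
  apply: le_lt_trans kv; apply: le_trans m1'.
  have : i%:R * s <= m%:R * s :> R by rewrite ler_pM2r// ler_nat -ltnS.
  lra.
have [f fP] := fin_all_exists ex.
have sub : [set f ia.1 + ia.2 |
    ia in finset.setX [set: 'I_m.+1]%SET (mulball s)]%SET \subset mulball k.
  apply/fintype.subsetP => y /imsetP[[i a]]; rewrite finset.in_setX !inE /= => as_ ->.
  apply: le_trans (mulnormD _ _ _ _ _ _) _ => //.
  have /andP[_ fi] := fP i; apply: le_trans m1'.
  have : i%:R * s <= m%:R * s :> R by rewrite ler_pM2r// ler_nat -ltnS.
  move: fi as_; rewrite /N; lra.
have lt_of (i j : 'I_m.+1) a b : (i < j)%N -> N a <= s -> N b <= s -> f i + a <> f j + b.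
  move=> ij as_ bs e.
  have : N (f j) <= N (f i) + (N a + N b).
    rewrite (_ : f j = f i + (a - b)); last by rewrite addrA e addrK.
    by apply: le_trans (mulnormD _ _ _ _ _ _) _ => //; rewrite lerD2l mulnormB.
  have /andP[_ fi] := fP i; have /andP[fj _] := fP j.
  have : i.+1%:R * s <= j%:R * s by rewrite ler_pM2r// ler_nat.
  rewrite -natr1 mulrDl; lra.
have := subset_leq_card sub; rewrite card_in_imset; last first.
  move=> [i a] [j b]; rewrite !finset.in_setX !inE /= => as_ bs e.
  have [ij|ji|/val_inj ij] := ltngtP i j.
  - by case: (lt_of i j a b).
  - by case: (lt_of j i b a).
  - by move: e; rewrite ij => /addrI ->.
rewrite cardsX cardsT card_ord -(ler_nat R) natrM => h.
rewrite mulrAC ler_pdivlMr//.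
have : k <= 6 * s * m.+1%:R.
  have : k / s <= 6 * m.+1%:R by lra.
  by rewrite ler_pdivrMr// => ?; lra.
move=> km; apply: (@le_trans _ _ (6 * s * (m.+1%:R * #|mulball s|%:R))); last first.
  by rewrite ler_pM2l// mulr_gt0.
by rewrite mulrC mulrA ler_wpM2r.
Qed.

End Packing.

(** * Counting the points of a ball by means of the ULCD *)

Section UlcdCounting.
Context (R : realType) (p n : nat) (w : 'rV[int]_n) (gamma kappa : R).
Hypotheses (p_pr : prime p) (p_ge3 : (3 <= p)%N).
Hypotheses (gamma_gt0 : 0 < gamma) (kappa_gt0 : 0 < kappa).

Let p_gt0 : 0 < p%:R :> R.
Proof. by rewrite ltr0n prime_gt0. Qed.

Let W : R := norm2 (scale_inv p w).
Let L := ulcd gamma kappa (scale_inv p w : 'rV[R]_n).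

(** Passing from [l * w] to its symmetric residues subtracts [p * z] with [z] integral, so [z] is a
    lattice point at the stated distance. *)
Lemma dist_int_le_mulnorm (l : nat) :
  dist_int (l%:R *: scale_inv p w : 'rV[R]_n) <= mulnorm R w (l%:R : 'F_p).
Proof.
pose z : 'rV[int]_n := \row_i divz (l%:Z * w 0 i - crep (l%:R * (w 0 i)%:~R : 'F_p)) p%:Z.
have zE i : (l%:Z * w 0 i - crep (l%:R * (w 0 i)%:~R : 'F_p)) = z 0 i * p%:Z.
  rewrite mxE divzK// -(intr_Fp_eq0 p_pr) intrB crepK// intrM -pmulrn subrr//.
apply: (@le_trans _ _ (norm2 (l%:R *: scale_inv p w - int_row z : 'rV[R]_n))).
  apply: ge_inf; last by exists z.
  by exists 0 => _ [y _ <-]; exact: norm2_ge0.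
apply: ler_norm2 => i; rewrite scale_invE !mxE.
rewrite le_eqVlt; apply/orP; left; apply/eqP; congr (`| _ |).
have := congr1 (fun y : int => y%:~R : R) (zE i).
rewrite mxE intrB !intrM -!pmulrn => e.
apply: (mulIf (lt0r_neq0 p_gt0)); rewrite mulrBl divfK ?gt_eqF// -e.
by field; rewrite gt_eqF.
Qed.

Lemma ulcd_gt0 : (0 < L)%N.
Proof. by have [/andP[]] := ulcdP w (prime_gt0 p_pr) (ltW gamma_gt0) (ltW kappa_gt0). Qed.

Lemma ulcd_le : (L <= p)%N.
Proof.
have [_] := ulcdP w (prime_gt0 p_pr) (ltW gamma_gt0) (ltW kappa_gt0); apply.
rewrite /ulcd_pred prime_gt0//=; apply: le_trans (dist_int_le_mulnorm p) _.
rewrite pchar_Fp_0// mulnorm0// le_min (ltW kappa_gt0) andbT.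
by rewrite mulr_ge0 ?norm2_ge0// ltW.
Qed.

(** By minimality [l] violates the ULCD inequality; since the distance is at most
    [mulnorm <= kappa], the violated bound is the one with [gamma]. *)
Lemma mulnorm_gt_below_ulcd (l : nat) : (0 < l < L)%N ->
  mulnorm R w (l%:R : 'F_p) <= kappa -> gamma * (l%:R * W) < mulnorm R w (l%:R : 'F_p).
Proof.
move=> /andP[l0 lL] lk.
have [_ Lmin] := ulcdP w (prime_gt0 p_pr) (ltW gamma_gt0) (ltW kappa_gt0).
have : ~~ ulcd_pred gamma kappa (scale_inv p w : 'rV[R]_n) l.
  by apply/negP => /Lmin; rewrite leqNgt lL.
rewrite /ulcd_pred l0 /= -ltNge gt_min norm2Z// => h.
have := dist_int_le_mulnorm l.
by case/orP: h => h dl; have := lt_le_trans h dl => //; rewrite ltNge lk.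
Qed.

(** Cut [[0, p)] into cells of length [L]. Two ball points of one cell differ by less than [L], and
    their difference has norm at most [2 k <= kappa], so they are at most [D] apart; a cell thus
    holds at most [truncn D + 1] points. *)
Lemma card_mulball_ulcd (k : R) : 0 < W -> 0 <= k -> 2 * k <= kappa ->
  #|mulball p w k|%:R <= 2 * p%:R / L%:R * (2 * k / (gamma * W) + 1) :> R.
Proof.
move=> W0 k0 kk; set D := 2 * k / (gamma * W).
have D0 : 0 <= D by rewrite divr_ge0 ?mulr_ge0// ltW.
have gap (u v : 'F_p) : u \in mulball p w k -> v \in mulball p w k ->
    (u <= v)%N -> (v - u < L)%N -> (v - u <= Num.truncn D)%N.
  rewrite !inE => uk vk uv vuL.
  have [->//|vu0] := posnP (v - u).
  have vuE : (v - u)%N%:R = v - u :> 'F_p by rewrite natrB// !natr_Zp.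
  have vu2 : mulnorm R w ((v - u)%N%:R : 'F_p) <= 2 * k.
    by rewrite vuE; apply: le_trans (mulnormB _ _ _ _ _ _) _ => //; lra.
  have := @mulnorm_gt_below_ulcd (v - u)%N.
  rewrite vu0 vuL => /(_ isT (le_trans vu2 kk)) h.
  rewrite truncn_ge_nat// /D ler_pdivlMr ?mulr_gt0//.
  by rewrite mulrCA; apply/ltW/(lt_le_trans h).
have L0 := ulcd_gt0.
pose q := (p %/ L)%N.
pose cell (u : 'F_p) : 'I_q.+1 := inord (u %/ L).
have cellE u : cell u = (u %/ L)%N :> nat.
  by rewrite inordK// ltnS leq_div2r// ltnW// ltn_Fp.
have card_cell c : (#|[set u in mulball p w k | cell u == c]%SET| <= (Num.truncn D).+1)%N.
  set S := [set _ in _ | _]%SET.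
  have [->|/set0Pn[u1 u1S]] := eqVneq S finset.set0; first by rewrite cards0.
  case: (arg_minnP (fun u : 'F_p => u : nat) u1S) => u uS umin.
  pose h (v : 'F_p) : 'I_(Num.truncn D).+1 := inord (v - u).
  have vu v : v \in S -> (v - u < (Num.truncn D).+1)%N.
    move=> vS; have uv := umin _ vS.
    move: uS vS => /finset.setIdP[uk /eqP uc] /finset.setIdP[vk /eqP vc].
    rewrite ltnS gap//.
    have e : (v %/ L = u %/ L)%N by rewrite -!cellE uc vc.
    apply: leq_ltn_trans (ltn_pmod v L0).
    by rewrite leq_subLR {1}(divn_eq v L) e leq_add2r leq_trunc_div.
  have hinj : {in S &, injective h}.
    move=> v v' vS v'S /(congr1 val); rewrite /h /= !inordK ?vu// => e.
    by apply: val_inj => /=; rewrite -(subnK (umin _ vS)) e subnK// umin.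
  by rewrite -(card_in_imset hinj) -[leqRHS]card_ord max_card.
have : (#|mulball p w k| <= q.+1 * (Num.truncn D).+1)%N.
  rewrite -sum1_card (partition_big cell xpredT)//=.
  rewrite -[X in (_ <= X * _)%N]card_ord -sum_nat_const.
  apply: leq_sum => c _; rewrite sum1_card; apply: leq_trans (card_cell c).
  apply: subset_leq_card; apply/fintype.subsetP => u uc.
  by apply/finset.setIdP/andP; exact: uc.
rewrite -(ler_nat R) natrM => /le_trans; apply.
apply: ler_pM => //; last by rewrite -natr1 lerD2r truncn_le.
have L0' : 0 < L%:R :> R by rewrite ltr0n.
(* The incomplete last cell is absorbed by [L <= p], whence the factor 2. *)
rewrite ler_pdivlMr// -!natrM ler_nat mulSn.
by have := ulcd_le; have := leq_trunc_div p L; rewrite -/q; lia.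
Qed.

End UlcdCounting.

(** * A lower bound on the mean square of [mulnorm] *)

Section AverageNorm.
Context (R : realType) (p n : nat) (w : 'rV[int]_n).
Hypotheses (p_pr : prime p) (p_ge3 : (3 <= p)%N).
Hypothesis w_le : forall i, `|w 0 i|%:~R <= p%:R / 2 :> R.

Let p_gt0 : 0 < p%:R :> R.
Proof. by rewrite ltr0n prime_gt0. Qed.

Let g (a : 'F_p) : R := ((crep a)%:~R / p%:R) ^+ 2.

(* One of [a] and [a + (p-1)/2] is far from 0. *)
Lemma sum_crep_sqr : p%:R / 36 <= \sum_a g a.
Proof.
pose h : 'F_p := (p.-1./2)%:R.
have ch : `|crep h| = (p.-1./2)%:Z.
  rewrite /crep /h val_Fp_nat// modn_small; last by lia.
  by rewrite leqnn.
(* [|crep h| = (p - 1) / 2 >= p / 3], so the two residues have absolute values summing to at least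
   [p / 3]; their squares over [p^2] then sum to at least [(1/3)^2 / 2]. *)
have pair a : 18^-1 <= g a + g (a + h).
  have : `|crep h| <= `|crep (a + h)| + `|crep a|.
    by have := crepD p_pr p_ge3 (a + h) (- a); rewrite crepN// addrAC subrr add0r.
  rewrite ch => e.
  have {e} : p%:Z <= 3 * (`|crep (a + h)| + `|crep a|).
    by have := prime_ge3_odd p_pr p_ge3; lia.
  rewrite -(ler_int R) intrM [X in _ * X]intrD !intr_norm -!pmulrn /g => e.
  rewrite !expr_div_n -mulrDl ler_pdivlMr ?exprn_gt0//.
  rewrite -[_%:~R ^+ 2]real_normK ?num_real// -[X in _ <= _ + X]real_normK ?num_real//.
  set x := `|_| in e *; set y := `|_| in e *.
  have e2 : p%:R ^+ 2 <= (3 * (x + y)) ^+ 2 :> R.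
    by rewrite lerXn2r ?nnegrE ?mulr_ge0 ?addr_ge0 ?normr_ge0// ltW.
  have := sqr_ge0 (x - y); lra.
have : \sum_a (g a + g (a + h)) = 2 * \sum_a g a.
  by rewrite big_split /= mulr_natl mulr2n [X in _ = _ + X](reindex_inj (addIr h)).
have : p%:R / 18 <= \sum_a (g a + g (a + h)).
  rewrite -{1}(card_Fp p_pr) mulr_natl -sumr_const; apply: ler_sum => a _; exact: pair.
lra.
Qed.

Lemma supp_unit i : i \in supp w -> (w 0 i)%:~R != 0 :> 'F_p.
Proof.
rewrite inE intr_Fp_eq0// => wi; apply/negP; rewrite dvdzE => /dvdn_leq.
rewrite absz_gt0 => /(_ wi); apply/negP; rewrite -ltnNge.
have := w_le i; rewrite -abszE -pmulrn absz_nat -(ltr_nat R) => wp; move: p_gt0; lra.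
Qed.

(** For [i] in the support, multiplication by [w 0 i] permutes ['F_p], so each such coordinate
    contributes the full sum of [sum_crep_sqr]. *)
Lemma sum_mulnorm_sqr : p%:R * #|supp w|%:R / 36 <= \sum_(u : 'F_p) mulnorm R w u ^+ 2.
Proof.
under eq_bigr do rewrite mulnorm_sqr//.
rewrite exchange_big /= (bigID (mem (supp w))) /= ler_wpDr//.
  by apply: sumr_ge0 => i _; apply: sumr_ge0 => u _; exact: sqr_ge0.
rewrite mulrAC [_ * _%:R]mulrC mulr_natl -sumr_const; apply: ler_sum => i wi.
apply: le_trans sum_crep_sqr _.
by rewrite (reindex_inj (mulIf (supp_unit wi))).
Qed.

Lemma exists_large_mulnorm (k : R) :
  0 <= k -> k ^+ 2 < #|supp w|%:R / 36 -> exists u : 'F_p, k < mulnorm R w u.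
Proof.
move=> k0 ks; apply: contrapT => /forallNP h.
have : \sum_(u : 'F_p) mulnorm R w u ^+ 2 <= \sum_(u : 'F_p) k ^+ 2.
  apply: ler_sum => u _; rewrite lerXn2r ?nnegrE ?mulnorm_ge0// leNgt; exact/negP.
rewrite sumr_const card_Fp// -mulr_natl => /(le_trans sum_mulnorm_sqr).
by rewrite -mulrA ler_pM2l// leNgt ks.
Qed.

End AverageNorm.

(** * Gaussian sums over shells *)

Section GaussianSum.
Context (R : realType) (p n : nat) (w : 'rV[int]_n).
Hypotheses (p_pr : prime p) (p_ge3 : (3 <= p)%N).

Lemma sum_succ_gauss_le (m : nat) :
  \sum_(j < m) j.+1%:R * expR (- (j%:R ^+ 2 / 2)) <= 16 :> R.
Proof.
(* The stronger bound telescopes: each term is at most [16 / ((j + 1) (j + 2))]. *)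
suff : \sum_(j < m) j.+1%:R * expR (- (j%:R ^+ 2 / 2)) <= 16 * (1 - m.+1%:R^-1) :> R.
  by move=> /le_trans; apply; rewrite ler_piMr// lerBlDr lerDl invr_ge0.
elim: m => [|m IHm]; first by rewrite big_ord0 invr1 subrr mulr0.
rewrite big_ord_recr /=.
apply: le_trans (lerD IHm (_ : _ <= 16 * (m.+1%:R^-1 - m.+2%:R^-1))) _; last first.
  by rewrite -mulrDr addrA subrK.
rewrite expRN ler_pdivrMr ?expR_gt0//.
have := @expR_ge1Dxn R (m%:R ^+ 2 / 2) 1 _; rewrite divr_ge0 ?sqr_ge0// => /(_ isT).
rewrite (_ : 2`! = 2)%N; last by [].
rewrite -[m.+2%:R]natr1 -[m.+1%:R]natr1.
set y : R := m%:R; have y0 : 0 <= y by rewrite ler0n.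
have -> : (y + 1)^-1 - (y + 1 + 1)^-1 = ((y + 1) * (y + 2))^-1.
  by field; rewrite !gt_eqF//; lra.
move=> hy; rewrite -ler_pdivrMl; last by rewrite mulr_gt0// invr_gt0 mulr_gt0//; lra.
apply: le_trans hy; rewrite invfM invrK -subr_ge0.
(* The exponential was replaced by [1 + y^4 / 8]; the remaining quartic is positive as a sum of
   squares. *)
have -> : 1 + (y ^+ 2 / 2) ^+ 2 / 2 - 16^-1 * ((y + 1) * (y + 2)) * (y + 1) =
  (2 * (y ^+ 2 - y / 4 - 2) ^+ 2 + (31 / 8 * (y - 28 / 31) ^+ 2 + 88 / 31)) / 16.
  by field.
by rewrite divr_ge0// addr_ge0// ?addr_ge0// mulr_ge0// sqr_ge0.
Qed.

Lemma sum_gauss_mulnorm_le (k : R) (v : 'F_p) : 0 < k -> k < mulnorm R w v ->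
  \sum_(u : 'F_p | u != 0) expR (- (mulnorm R w u ^+ 2 / 2)) <=
  p%:R * expR (- (k ^+ 2 / 2)) + 96 / k * #|mulball p w k|%:R.
Proof.
move=> k0 kv; pose N (u : 'F_p) := mulnorm R w u.
(* The shell [j] is [truncn (N u) = j]. Its outer radius is capped at [k], as packing requires
   [s <= k]. *)
pose m := (Num.truncn k).+1; pose s (j : nat) : R := Num.min j.+1%:R k.
pose e (j : nat) : R := expR (- (j%:R ^+ 2 / 2)).
have pointwise (u : 'F_p) : expR (- (N u ^+ 2 / 2)) <=
    expR (- (k ^+ 2 / 2)) + \sum_(j < m) e j * (N u <= s j)%R%:R.
  have sum0 : 0 <= \sum_(j < m) e j * (N u <= s j)%R%:R.
    by apply: sumr_ge0 => j _; rewrite mulr_ge0 ?expR_ge0.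
  have [Nk|/ltW kN] := leP (N u) k; last first.
    rewrite ler_wpDr// ler_expR lerN2 ler_pM2r// lerXn2r ?nnegrE ?mulnorm_ge0//.
    exact: ltW.
  rewrite ler_wpDl ?expR_ge0//.
  have N0 : 0 <= N u by exact: mulnorm_ge0.
  have /andP[N1 N2] := truncn_itv N0.
  have jm : (Num.truncn (N u) < m)%N by rewrite ltnS le_truncn.
  rewrite (bigD1 (Ordinal jm))//= ler_wpDr//.
    by apply: sumr_ge0 => j _; rewrite mulr_ge0 ?expR_ge0.
  rewrite /s le_min (ltW N2) Nk mulr1 ler_expR lerN2 ler_pM2r//.
  by rewrite lerXn2r ?nnegrE.
have count (j : nat) : \sum_(u : 'F_p | u != 0) (N u <= s j)%R%:R <=
    6 / k * #|mulball p w k|%:R * j.+1%:R :> R.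
  (* Packing needs a non-zero point in the small ball; if there is none, the sum on the left
     vanishes. *)
  have [/existsP[u /andP[u0 us]]|] := boolP [exists u : 'F_p, (u != 0) && (N u <= s j)].
    apply: (@le_trans _ _ #|mulball p w (s j)|%:R).
      rewrite -sum1_card natr_sum big_mkcond [leRHS]big_mkcond /=.
      by apply: ler_sum => y _; rewrite inE; case: ifP => //; case: ifP.
    have s0 : 0 < s j by rewrite lt_min k0 ltr0n.
    have sk : s j <= k by rewrite ge_min lexx orbT.
    apply: le_trans (card_mulball_packing p_pr p_ge3 s0 sk u0 us kv) _.
    rewrite [leRHS]mulrAC ler_wpM2r// [leRHS]mulrAC ler_wpM2r ?invr_ge0 ?(ltW k0)//.
    by rewrite ler_pM2l// ge_min lexx.
  rewrite negb_exists => /forallP h; rewrite big1 => [|u u0].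
    by rewrite !mulr_ge0 ?invr_ge0 ?(ltW k0).
  by have := h u; rewrite u0 /= => /negPf ->.
apply: le_trans (ler_sum _ (fun u _ => pointwise u)) _.
rewrite big_split /= exchange_big /=; apply: lerD.
  apply: (@le_trans _ _ (\sum_(u : 'F_p) expR (- (k ^+ 2 / 2)))); last first.
    by rewrite sumr_const card_Fp// mulr_natl.
  rewrite big_mkcond; apply: ler_sum => u _.
  by case: ifP => // _; exact: expR_ge0.
apply: (@le_trans _ _ (\sum_(j < m) 6 / k * #|mulball p w k|%:R * (j.+1%:R * e j))).
  apply: ler_sum => j _; rewrite -mulr_sumr mulrA [leRHS]mulrC.
  by rewrite ler_wpM2l ?expR_ge0.
rewrite -mulr_sumr; apply: le_trans (ler_wpM2l _ (sum_succ_gauss_le m)) _.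
  by rewrite !mulr_ge0 ?invr_ge0 ?(ltW k0).
by rewrite le_eqVlt; apply/orP; left; apply/eqP; field; rewrite gt_eqF.
Qed.

End GaussianSum.

(** * The bound on [rho] through the ULCD, and the choice of constants *)

Lemma rho_ulcd_le (R : realType) (p n : nat) (gamma kappa k : R) (w : 'rV[int]_n)
    (d : measure_display) (T : measurableType d) (P : probability T R)
    (x : 'I_n -> {RV P >-> int}) :
  let W : R := norm2 (scale_inv p w) in
  prime p -> (3 <= p)%N -> iid_signs x ->
  (forall i, `|w 0 i|%:~R <= p%:R / 2 :> R) ->
  0 < gamma -> 0 < W -> 0 < k -> 2 * k <= kappa ->
  k ^+ 2 < #|supp w|%:R / 36 ->
  rho p x w <= expR (- (k ^+ 2 / 2)) +
    192 / (ulcd gamma kappa (scale_inv p w : 'rV[R]_n))%:R * (2 / (gamma * W) + k^-1).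
Proof.
move=> W p_pr p_ge3 x_signs w_le gamma0 W0 k0 kk ks.
have p0 : 0 < p%:R :> R by rewrite ltr0n prime_gt0.
have kappa0 : 0 < kappa by apply: lt_le_trans kk; rewrite mulr_gt0.
have [v kv] := exists_large_mulnorm p_pr p_ge3 w_le (ltW k0) ks.
apply: le_trans (rho_fourier w p_pr p_ge3 x_signs) _.
rewrite mulrC ler_pdivrMr//.
apply: le_trans (sum_gauss_mulnorm_le p_pr p_ge3 k0 kv) _.
rewrite [leRHS]mulrDl [_ * expR _]mulrC lerD2l.
apply: le_trans (ler_wpM2l _ (card_mulball_ulcd p_pr p_ge3 gamma0 kappa0 W0 (ltW k0) kk)) _.
  by rewrite divr_ge0// ltW.
have L0 : 0 < (ulcd gamma kappa (scale_inv p w : 'rV[R]_n))%:R :> R.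
  by rewrite ltr0n; exact: ulcd_gt0.
(* The 192 is the product of 96 from the shells and 2 from the cells. *)
rewrite le_eqVlt; apply/orP; left; apply/eqP; rewrite -/W.
by field; rewrite !gt_eqF.
Qed.

Theorem theorem4p4 (R : realType) (C gamma cnsp : R) :
  0 < C -> 0 < gamma < 1 -> 0 < cnsp ->
  exists K c : R, [/\ 0 < K, 0 < c &
    forall (p n : nat) (kappa : R) (w : 'rV[int]_n)
      (d : measure_display) (T : measurableType d) (P : probability T R)
      (x : 'I_n -> {RV P >-> int}),
    prime p -> (3 <= p)%N -> 0 < kappa ->
    w != 0 -> (forall i, `|w 0 i|%:~R <= p%:R / 2 :> R) ->
    iid_signs x ->
    let small_multiple := exists t : 'F_p,
      t != 0 /\ norm2 (scale_inv p (modp_scale t w)) < kappa in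
    (~ small_multiple -> rho p x w <= expR (- (kappa ^+ 2 / 2))) /\
    (small_multiple ->
     forall L : R, 0 < L ->
     1 <= norm2 (scale_inv p w : 'rV[R]_n) <= kappa ->
     cnsp * n%:R <= #|supp w|%:R ->
     kappa <= C * Num.sqrt n%:R ->
     L <= (ulcd gamma kappa (scale_inv p w))%:R ->
     rho p x w <= K * ((L * norm2 (scale_inv p w))^-1
                       + expR (- (c * kappa ^+ 2))))].
Proof.
move=> C0 /andP[gamma0 _] cnsp0.
(* [c1 <= 1/2] gives [2 k <= kappa] for [k = c1 * kappa]. From [c1 * C <= b] and
   [b^2 <= b <= cnsp / 37] comes [k^2 <= cnsp * n / 37], strictly below [#|supp w| / 36]. *)
pose b := Num.min 1 (cnsp / 37); pose c1 := Num.min 2^-1 (b / C).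
have b0 : 0 < b by rewrite lt_min ltr01 divr_gt0.
have c10 : 0 < c1 by rewrite lt_min invr_gt0 divr_gt0//= ltr0n.
exists (1 + 192 * (2 / gamma + c1^-1)), (c1 ^+ 2 / 2); split.
- by rewrite ltr_wpDr// mulr_ge0// addr_ge0 ?divr_ge0 ?invr_ge0 ?(ltW gamma0) ?(ltW c10).
- by rewrite divr_gt0 ?exprn_gt0.
move=> p n kappa w d T P x p_pr p_ge3 kappa0 w0 w_le x_signs small; split.
  move=> nsmall; apply: rho_le_expR => // [|u u0]; first exact: ltW.
  by rewrite leNgt; apply/negP => uk; apply: nsmall; exists u.
move=> _ L L0 /andP[W1 Wk] hsupp kC hL.
set W := norm2 _ in W1 Wk *.
have W0 : 0 < W by exact: lt_le_trans W1.
have n0 : 0 < n%:R :> R.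
  rewrite ltr0n lt0n; apply: contra_neq w0 => n0.
  by apply/rowP => i; have := ltn_ord i; rewrite [X in (_ < X)%N]n0.
have k0 : 0 < c1 * kappa by rewrite mulr_gt0.
have kk : 2 * (c1 * kappa) <= kappa.
  have : c1 <= 2^-1 by rewrite ge_min lexx.
  by rewrite -(ler_pM2r kappa0) => ?; lra.
have ks : (c1 * kappa) ^+ 2 < #|supp w|%:R / 36.
  have c1C : c1 * C <= b by rewrite -ler_pdivlMr// ge_min lexx orbT.
  have kb : c1 * kappa <= b * Num.sqrt n%:R.
    apply: le_trans (ler_wpM2l (ltW c10) kC) _.
    by rewrite mulrA ler_wpM2r// sqrtr_ge0.
  have b1 : b <= 1 by rewrite ge_min lexx.
  have bc : b <= cnsp / 37 by rewrite ge_min lexx orbT.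
  have : (c1 * kappa) ^+ 2 <= cnsp / 37 * n%:R.
    apply: (@le_trans _ _ ((b * Num.sqrt n%:R) ^+ 2)).
      by rewrite lerXn2r ?nnegrE ?mulr_ge0 ?sqrtr_ge0 ?(ltW c10) ?(ltW kappa0) ?(ltW b0).
    rewrite exprMn sqr_sqrtr ?(ltW n0)// ler_pM2r//; apply: le_trans bc.
    by rewrite expr2 ler_piMr ?(ltW b0).
  have := mulr_gt0 cnsp0 n0; lra.
apply: le_trans (rho_ulcd_le p_pr p_ge3 x_signs w_le gamma0 W0 k0 kk ks) _.
set u := ulcd _ _ _ in hL *; set E := expR _.
have -> : E = expR (- (c1 ^+ 2 / 2 * kappa ^+ 2)) by congr expR; rewrite exprMn mulrAC.
pose D := 192 * (2 / gamma + c1^-1); rewrite -/D; set E' := expR _.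
have D0 : 0 <= D.
  by rewrite mulr_ge0// addr_ge0 ?divr_ge0 ?invr_ge0 ?(ltW gamma0) ?(ltW c10).
have LW0 : 0 <= (L * W)^-1 by rewrite invr_ge0 mulr_ge0 ?(ltW L0) ?(ltW W0).
have E0 : 0 <= E' by exact: expR_ge0.
(* [L] is at most the ULCD, and [W <= kappa] turns [1 / (c1 * kappa)] into at most [c1^-1 / W]. *)
have : 192 / u%:R * (2 / (gamma * W) + (c1 * kappa)^-1) <= D * (L * W)^-1.
  have -> : D * (L * W)^-1 = 192 / L * ((2 / gamma + c1^-1) / W).
    by rewrite /D; field; rewrite !gt_eqF.
  apply: ler_pM.
  - by rewrite divr_ge0.
  - by rewrite addr_ge0 ?divr_ge0 ?invr_ge0 ?mulr_ge0 ?(ltW gamma0)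
       ?(ltW W0) ?(ltW c10) ?(ltW kappa0).
  - by rewrite ler_pM2l// lef_pV2// posrE; exact: lt_le_trans hL.
  - rewrite [leRHS]mulrDl !invfM mulrA lerD2l ler_pM2l ?invr_gt0//.
    by rewrite lef_pV2// posrE.
have := mulr_ge0 D0 E0; rewrite mulrDl mul1r mulrDr; lra.
Qed.
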